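(* For an integer $d\ge 2$, let $c_d^m$ denote the number of crossing pairs of hyperedges of the complete $d$-uniform hypergraph $K^d_{2d}$ when its $2d$ vertices are placed at (any) $2d$ distinct points of the $d$-dimensional moment curve in $\mathbb{R}^d$. Then $$c_d^m=\begin{cases}\displaystyle\binom{2d-1}{d-1}-\sum_{i=1}^{d/2}\binom{d}{i}\binom{d-1}{i-1} & \text{if } d \text{ is even},\\[2mm] \displaystyle\binom{2d-1}{d-1}-1-\sum_{i=1}^{\lfloor d/2\rfloor}\binom{d-1}{i}\binom{d}{i} & \text{if } d \text{ is odd},\end{cases}$$ and $c_d^m=\Theta\!\left(\dfrac{4^d}{\sqrt{d}}\right)$ as $d\to\infty$.
   Context: The $d$-dimensional moment curve is $\gamma=\{(t,t^2,\ldots,t^d): t\in\mathbb{R}\}\subset\mathbb{R}^d$. The complete $d$-uniform hypergraph $K^d_{2d}$ has $2d$ vertices, and its hyperedges are all $d$-element subsets of the vertex set; each hyperedge is drawn as the $(d-1)$-simplex that is the convex hull of its $d$ vertices. Two hyperedges form a crossing pair if they are vertex-disjoint and the corresponding simplices have a common point in their relative interiors. Pairs of hyperedges are unordered. $f(d)=\Theta(g(d))$ means that there are constants $C_1,C_2>0$ and $d_0$ with $C_1 g(d)\le f(d)\le C_2 g(d)$ for all $d\ge d_0$. *)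

(* Defs.v *)
From mathcomp Require Import all_boot all_order all_algebra.
From mathcomp Require Import all_classical all_reals all_analysis.

Set Implicit Arguments.
Unset Strict Implicit.
Unset Printing Implicit Defensive.

Import Order.TTheory GRing.Theory Num.Theory.
Import numFieldNormedType.Exports.

Local Open Scope classical_set_scope.
Local Open Scope ring_scope.

Definition moment_curve (R : realType) (d : nat) : set 'rV[R]_d :=
  range (fun t : R => \row_(i < d) t ^+ i.+1).

Definition convex_hull (R : realType) (d : nat) (A : set 'rV[R]_d) :
    set 'rV[R]_d :=
  smallest (@convex_set R 'rV[R]_d) A.

Definition affine_hull (R : realType) (d : nat) (A : set 'rV[R]_d) :
    set 'rV[R]_d :=
  [set x | exists (n : nat) (a : 'I_n -> 'rV[R]_d) (w : 'I_n -> R),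
     [/\ forall i, A (a i), \sum_i w i = 1 & x = \sum_i w i *: a i]].

(* [nbhs] on ['rV[R]_d] is the product topology, i.e. the Euclidean one. *)
Definition relative_interior (R : realType) (d : nat) (A : set 'rV[R]_d) :
    set 'rV[R]_d :=
  [set x | A x /\ within (affine_hull A) (nbhs x) A].

Definition hyperedges (d : nat) : {set {set 'I_(2 * d)}} :=
  [set e : {set 'I_(2 * d)} | #|e| == d].

Definition simplex (R : realType) (d : nat) (p : 'I_(2 * d) -> 'rV[R]_d)
    (e : {set 'I_(2 * d)}) : set 'rV[R]_d :=
  convex_hull [set p v | v in [set` e]].

Definition crossing (R : realType) (d : nat) (p : 'I_(2 * d) -> 'rV[R]_d)
    (e f : {set 'I_(2 * d)}) : Prop :=
  [disjoint e & f]%bool /\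
  relative_interior (simplex p e) `&` relative_interior (simplex p f) !=set0.

(* Unordered pairs are the doubletons [set e; f] of hyperedges. *)
Definition crossing_pairs (R : realType) (d : nat)
    (p : 'I_(2 * d) -> 'rV[R]_d) : {set {set {set 'I_(2 * d)}}} :=
  [set [set e; f]%SET | e in hyperedges d, f in hyperedges d
     & `[< crossing p e f >]]%SET.

(* Main.v *)
Require Import Defs.
From mathcomp Require Import all_boot all_order all_algebra.
From mathcomp Require Import all_classical all_reals all_analysis.
From mathcomp Require Import zify ring lra.

Set Implicit Arguments.
Unset Strict Implicit.
Unset Printing Implicit Defensive.

Import Order.TTheory GRing.Theory Num.Theory.
Import numFieldNormedType.Exports.

(** Two disjoint hyperedges use up all [2 * d] vertices, so a crossing pair is
    a bipartition of the vertices into [e] and [~: e] such that the two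
    simplices have a common point with positive barycentric coordinates on both
    sides. Equivalently, there are weights [l v], negative exactly for [v] in
    [e], that form an affine dependence of the points. On the moment curve this
    means that [\sum_v l v * q.[t v] = 0] for all polynomials [q] of degree at
    most [d], where [t v] is the parameter of [v] ([crossing_signedP]).

    List the vertices by increasing parameter and colour them by membership in
    [e]. Such weights exist exactly if the colour changes more than [d] times
    ([signed_dependenceP]). With at most [d] changes, a polynomial with one root
    inside each change has the signs of the colouring up to a global sign, and
    the sum above cannot vanish. With more changes, every vertex belongs to a
    set of [d.+2] vertices of alternating colours. The divided difference on
    this set kills the polynomials of degree at most [d] and has alternating
    weights; the sum of these functionals over all vertices has the required
    signs everywhere.

    It remains to count words with [d] letters of each colour, first letter
    fixed, and [r > d] changes. Cutting each colour class into runs gives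
    ['C(d.-1, r./2) * 'C(d.-1, r.-1./2)] words with [r] changes
    ([card_words_flips]). Over all [r] these numbers add up to
    ['C(2 * d - 1, d - 1)] by Vandermonde's identity; subtracting the terms with
    [r <= d], grouped in pairs, gives the two formulas. The numbers are also
    symmetric about [r = d], and the middle one is at most twice its neighbour.
    The crossing count therefore lies between a quarter of
    ['C(2 * d - 1, d - 1)] and this number, which is half of a central binomial
    coefficient and has the order of [4 ^ d / sqrt d]. *)

(** * Two-coloured words with a given number of changes *)

(** The first letter [b] is kept apart because it stays fixed in the count. *)
Fixpoint flips (b : bool) (s : seq bool) : nat :=
  if s is c :: s' then (b != c) + flips c s' else 0.

Lemma card_tuple_cons n (P : pred (seq bool)) (b : bool) :
  #|[set w : n.+1.-tuple bool | P w]| =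
  #|[set w : n.-tuple bool | P (b :: w)]|
    + #|[set w : n.-tuple bool | P (~~ b :: w)]|.
Proof.
have head_card c : #|[set w : n.+1.-tuple bool | P w & thead w == c]|
    = #|[set w : n.-tuple bool | P (c :: w)]|.
  rewrite -[RHS](card_imset _ (_ : injective (cons_tuple c))); last first.
    by move=> w w' /(congr1 val) [] /val_inj.
  apply: eq_card => w; rewrite inE; apply/andP/imsetP => [[Pw /eqP wc]|].
    case/tupleP: w Pw wc => x w; rewrite theadE => Pw xc; subst c.
    by exists w; rewrite ?inE //; apply: val_inj.
  by case=> w'; rewrite inE => Pw' ->; rewrite theadE eqxx.
rewrite -!head_card -(cardsID [set w : n.+1.-tuple bool | thead w == b]).
congr (_ + _); apply: eq_card => w; rewrite !inE //.
by rewrite andbC; case: (P w); case: (thead w); case: b.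
Qed.

Lemma count_mem_negb (b : bool) (s : seq bool) :
  count_mem (~~ b) s = size s - count_mem b s.
Proof.
rewrite -(count_predC (pred1 b) s) addKn; apply: eq_count => c.
by case: b; case: c.
Qed.

(** Choosing how the [m.+1] letters of the first colour are cut into
    [r./2.+1] runs, and the [k] letters of the other colour into
    [uphalf r] runs. *)
Definition word_count (m k r : nat) : nat :=
  if r is r'.+1 then (0 < k) * ('C(m, r./2) * 'C(k.-1, r'./2)) else (k == 0).

(** The runs of a word alternate in colour, so a word is a pair of
    compositions. The induction removes the first letter: keeping the colour
    lowers [m]; changing it swaps the roles of [m] and [k] and uses up one
    change, and Pascal's rule merges the two cases. *)
Lemma card_words_flips n m k b r : n = m + k ->
  #|[set w : n.-tuple bool | (count_mem b w == m) && (flips b w == r)]| =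
  word_count m k r.
Proof.
elim: n m k b r => [|n IHn] m k b r.
  move=> /esym /eqP; rewrite addn_eq0 => /andP[/eqP -> /eqP ->].
  case: r => [|r] /=; last first.
    by apply/eqP; rewrite cards_eq0; apply/eqP/setP => w; rewrite tuple0 !inE.
  rewrite -[RHS](card_tuple 0 bool) -cardsT; apply: eq_card => w.
  by rewrite tuple0 !inE.
move=> def_n.
rewrite (card_tuple_cons _ (fun w => (count_mem b w == m) && (flips b w == r)) b).
have -> : #|[set w : n.-tuple bool | (count_mem b (b :: w) == m)
    && (flips b (b :: w) == r)]| =
  if m is m'.+1 then word_count m' k r else 0.
  case: m def_n => [|m'] def_n.
    by apply/eqP; rewrite cards_eq0; apply/eqP/setP => w; rewrite !inE /= eqxx.
  rewrite -(IHn _ _ b); last lia.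
  by apply: eq_card => w; rewrite !inE /= eqxx.
have -> : #|[set w : n.-tuple bool | (count_mem b (~~ b :: w) == m)
    && (flips b (~~ b :: w) == r)]| =
  if k is k'.+1 then if r is r'.+1 then word_count k' m r' else 0 else 0.
  case: k def_n => [|k'] def_n; last case: r => [|r'].
  - apply/eqP; rewrite cards_eq0; apply/eqP/setP => w; rewrite !inE /=.
    apply: contraTF (count_size (pred1 b) w) => /andP[/eqP].
    by rewrite size_tuple; case: (b) => /= *; lia.
  - apply/eqP; rewrite cards_eq0; apply/eqP/setP => w; rewrite !inE /=.
    by case: (b); rewrite andbF.
  - rewrite -(IHn _ _ (~~ b)); last lia.
    apply: eq_card => w; rewrite !inE /= count_mem_negb size_tuple.
    have := count_size (pred1 b) w; rewrite size_tuple.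
    by case: (b) => /= *; lia.
case: r => [|r']; first by case: k m def_n => [|?] [|?].
case: k def_n => [|k'] def_n; first by case: m def_n => [|?].
case: r' => [|[|r'']] /=.
- by case: m def_n => [|?] _; rewrite /word_count /= ?bin0.
- by case: m {def_n} => [|m]; rewrite /word_count /= ?bin0n ?bin0 ?bin1 //=; lia.
- case: m {def_n} => [|m]; first by rewrite /word_count /= bin0n.
  by rewrite /word_count /= !mul1n binS; lia.
Qed.

(** * Size of the crossing count *)

(** The case [m = d.-1], [k = d] of [word_count]: the number of words with
    [d] letters of each colour, first letter fixed and [r > 0] changes. *)
Definition flip_weight (d r : nat) : nat := 'C(d.-1, r./2) * 'C(d.-1, r.-1./2).

Definition crossing_count (d : nat) : nat :=
  \sum_(d.+1 <= r < 2 * d) flip_weight d r.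

Lemma flips_le_size b s : flips b s <= size s.
Proof. by elim: s b => //= c s IHs b; have := IHs c; case: (b == c); lia. Qed.

Lemma card_words_many_flips d : 0 < d ->
  #|[set w : (2 * d).-1.-tuple bool |
      (count_mem true w == d.-1) && (d < flips true w)]| = crossing_count d.
Proof.
move=> d_gt0; rewrite -sum1dep_card big_mkcond /=.
have -> : crossing_count d = \sum_(d.+1 <= r < 2 * d)
    \sum_(w : (2 * d).-1.-tuple bool)
      ((count_mem true w == d.-1) && (flips true w == r)).
  apply: eq_big_nat => -[|r] // _; transitivity (word_count d.-1 d r.+1).
    by rewrite /word_count d_gt0 mul1n.
  rewrite -(@card_words_flips (2 * d).-1 _ _ true); last lia.
  by rewrite -sum1dep_card big_mkcond; apply: eq_bigr => w _; case: (_ && _).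
rewrite exchange_big; apply: eq_bigr => w _ /=.
case: (count_mem true w == d.-1) => /=; last by rewrite big1.
have := flips_le_size true w; rewrite size_tuple => flips_le.
case: ltnP => [lt_d|le_d].
  have flips_lt : flips true w < 2 * d by lia.
  rewrite (big_cat_nat lt_d (ltnW flips_lt)) /= [X in _ + X]big_ltn //.
  rewrite eqxx big1_seq; last by move=> r; rewrite mem_index_iota; case: eqP => //=; lia.
  by rewrite big1_seq // => r; rewrite mem_index_iota; case: eqP => //=; lia.
by rewrite big1_seq // => r; rewrite mem_index_iota; case: eqP => //=; lia.
Qed.

(** Grouping [r = 2 * j] with [r = 2 * j + 1] and using Pascal's rule; the
    term [r = 1] stands alone and is the summand [j = 0]. *)
Lemma sum_flip_weight_odd d k : 0 < d ->
  \sum_(1 <= r < 2 * k) flip_weight d r = \sum_(j < k) 'C(d.-1, j) * 'C(d, j).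
Proof.
case: d => // d _; elim: k => [|k IHk]; first by rewrite big_geq ?big_ord0.
rewrite big_ord_recr -IHk mulnSr addn2.
case: k {IHk} => [|k]; first by rewrite muln0 big_nat1 big_geq // /flip_weight /= !bin0.
move def_N: (2 * k.+1) => N.
rewrite [LHS]big_nat_recr //= [X in X + _ = _]big_nat_recr /=; last lia.
rewrite -addnA; congr (_ + _); rewrite /flip_weight /=.
have -> : N./2 = k.+1 by lia.
have -> : N.-1./2 = k by lia.
have -> : uphalf N = k.+1 by lia.
by rewrite binS mulnDr addnC.
Qed.

(** Here the groups are [r = 2 * j - 1] and [r = 2 * j]. *)
Lemma sum_flip_weight_even d k : 0 < d ->
  \sum_(1 <= r < (2 * k).+1) flip_weight d r =
  \sum_(1 <= j < k.+1) 'C(d, j) * 'C(d.-1, j.-1).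
Proof.
case: d => // d _; elim: k => [|k IHk]; first by rewrite !big_geq.
rewrite [RHS]big_nat_recr //= -IHk mulnSr addn2.
move def_N: (2 * k) => N.
rewrite [LHS]big_nat_recr //= [X in X + _ = _]big_nat_recr //= -addnA.
congr (_ + _); rewrite /flip_weight /=.
have -> : N./2 = k by lia.
have -> : uphalf N = k by lia.
by rewrite binS mulnDl addnC.
Qed.

Lemma sum_flip_weight d : 0 < d ->
  \sum_(1 <= r < 2 * d) flip_weight d r = 'C(2 * d - 1, d - 1).
Proof.
move=> d_gt0; rewrite sum_flip_weight_odd //.
have -> : 2 * d - 1 = d + d.-1 by lia.
case: d d_gt0 => // d _; rewrite subn1 /= -(binomial.Vandermonde d.+1 d d).
by apply: eq_bigr => j _; rewrite mulnC bin_sub // -ltnS.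
Qed.

Lemma crossing_count_split d : 0 < d ->
  crossing_count d + \sum_(1 <= r < d.+1) flip_weight d r = 'C(2 * d - 1, d - 1).
Proof.
move=> d_gt0; rewrite -sum_flip_weight // addnC /crossing_count.
by rewrite -big_cat_nat //; lia.
Qed.

(** The symmetry [r |-> 2 * d - r] of the weights, centred at [r = d]: it
    exchanges the two binomial factors after ['C(n, m) = 'C(n, n - m)]. *)
Lemma flip_weight_sym d i : i < d -> flip_weight d (d - i) = flip_weight d (i + d).
Proof.
move=> lt_id; rewrite /flip_weight mulnC.
by congr (_ * _); rewrite -[LHS]bin_sub; [congr 'C(_, _)| | congr 'C(_, _) |]; lia.
Qed.

(** By symmetry the weights below the middle index [d] add up to those
    above it. *)
Lemma crossing_count_double d : 0 < d ->
  'C(2 * d - 1, d - 1) = 2 * crossing_count d + flip_weight d d.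
Proof.
move=> d_gt0; rewrite -crossing_count_split // big_nat_recr //= addnA.
congr (_ + _); rewrite mul2n -addnn; congr (_ + _).
rewrite big_nat_rev /= /crossing_count -[d.+1]add1n big_addn.
have -> : 2 * d - d = d by lia.
by apply: eq_big_nat => i /andP[_ lt_id]; rewrite -flip_weight_sym // add1n subSS.
Qed.

(** The two weights share a factor; the other factors are consecutive binomial
    coefficients next to the middle of their row. *)
Lemma flip_weight_mid d : 1 < d -> flip_weight d d <= 2 * flip_weight d d.+1.
Proof.
move=> d_gt1; rewrite /flip_weight /= [leqRHS]mulnA [leqRHS]mulnC leq_mul2l.
apply/orP; right; have half_gt0 : 0 < d.-1./2.+1 by [].
have := mul_bin_left d.-1 d.-1./2; have -> : uphalf d = d.-1./2.+1 by lia.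
rewrite -(leq_pmul2l half_gt0) mulnCA => ->.
by rewrite mulnA leq_mul2r; apply/orP; right; lia.
Qed.

Lemma crossing_count_le d : 0 < d -> crossing_count d <= 'C(2 * d - 1, d - 1).
Proof. by move/crossing_count_split <-; exact: leq_addr. Qed.

(** The middle weight is at most twice its neighbour [flip_weight d d.+1],
    itself a term of [crossing_count d], so the symmetric decomposition of the
    total is at most [2 + 2] crossing counts. *)
Lemma crossing_count_ge d : 1 < d -> 'C(2 * d - 1, d - 1) <= 4 * crossing_count d.
Proof.
move=> d_gt1; rewrite crossing_count_double; last lia.
have : flip_weight d d.+1 <= crossing_count d.
  by rewrite /crossing_count big_ltn; [exact: leq_addr|lia].
by have := flip_weight_mid d_gt1; lia.
Qed.

Lemma central_bin_step d :
  d.+1 * 'C(2 * d.+1, d.+1) = 2 * (2 * d + 1) * 'C(2 * d, d).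
Proof.
have := mul_bin_diag (2 * d).+1 d; have := mul_bin_diag (2 * d).+2 d.
rewrite /= -(@bin_sub (2 * d).+1 d); last lia.
have -> : (2 * d).+1 - d = d.+1 by lia.
have -> : 2 * d.+1 = (2 * d).+2 by lia.
nia.
Qed.

(** Squaring keeps the bound [4 ^ d / (2 * sqrt d) <= 'C(2 * d, d)] inside the
    natural numbers; the induction step is [4 * d * d.+1 <= (2 * d + 1) ^ 2]. *)
Lemma central_bin_sqr_ge d : 0 < d -> 16 ^ d <= 4 * d * 'C(2 * d, d) ^ 2.
Proof.
elim: d => // -[|d] IHd _; first by [].
rewrite -(@leq_pmul2l d.+2) // (expnS 16).
have := central_bin_step d.+1; move: IHd => /(_ isT).
move: ('C(2 * d.+1, d.+1)) ('C(2 * d.+2, d.+2)) (16 ^ d.+1) => u v e.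
move=> IHd step.
have -> : d.+2 * (4 * d.+2 * v ^ 2) = 4 * (d.+2 * v) ^ 2 by lia.
rewrite step; apply: (@leq_trans (d.+2 * (16 * (4 * d.+1 * u ^ 2)))).
  by rewrite !leq_mul2l IHd !orbT.
by rewrite -!mulnn; lia.
Qed.

(** The factor [2 * d + 1], rather than [2 * d], makes the induction close,
    through [(2 * d + 1) * (2 * d + 3) <= 4 * d.+1 ^ 2]. *)
Lemma central_bin_sqr_le d : (2 * d + 1) * 'C(2 * d, d) ^ 2 <= 16 ^ d.
Proof.
elim: d => [|d IHd]; first by [].
rewrite -(@leq_pmul2l (d.+1 ^ 2)) // (expnS 16).
have := central_bin_step d; move: IHd.
move: ('C(2 * d, d)) ('C(2 * d.+1, d.+1)) (16 ^ d) => u v e IHd step.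
have -> : d.+1 ^ 2 * ((2 * d.+1 + 1) * v ^ 2) = (2 * d + 3) * (d.+1 * v) ^ 2 by lia.
rewrite step; apply: (@leq_trans (d.+1 ^ 2 * (16 * ((2 * d + 1) * u ^ 2)))).
  by rewrite -!mulnn; lia.
by rewrite !leq_mul2l IHd !orbT.
Qed.

Lemma central_bin_half d : 0 < d -> 'C(2 * d, d) = 2 * 'C(2 * d - 1, d - 1).
Proof.
case: d => // d _; have := mul_bin_diag (2 * d.+1) d.
rewrite subn1 subSS subn0 => bin_diag.
by apply/eqP; rewrite -(eqn_pmul2l (ltn0Sn d)) -bin_diag; lia.
Qed.

Lemma crossing_count_sqr_le d : 0 < d -> d * crossing_count d ^ 2 <= 16 ^ d.
Proof.
move=> d_gt0; apply: leq_trans (central_bin_sqr_le d).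
have := crossing_count_le d_gt0; rewrite central_bin_half //.
by move=> le_cw; apply: leq_mul; [lia | rewrite leq_exp2r //; lia].
Qed.

Lemma crossing_count_sqr_ge d : 1 < d -> 16 ^ d <= 256 * d * crossing_count d ^ 2.
Proof.
move=> d_gt1; apply: leq_trans (central_bin_sqr_ge (ltnW d_gt1)) _.
have := crossing_count_ge d_gt1; rewrite central_bin_half; last lia.
move: ('C(_, _)) (crossing_count d) => w c le_wc.
have : w ^ 2 <= (4 * c) ^ 2 by rewrite leq_exp2r.
by nia.
Qed.

Local Open Scope ring_scope.

(** * Divided differences *)

Definition node_poly (F : fieldType) (I : finType) (A : {set I}) (y : I -> F)
    (i : I) : {poly F} :=
  \prod_(j in A :\ i) ('X - (y j)%:P).

Section Interpolation.
Variables (F : fieldType) (I : finType) (A : {set I}) (y : I -> F).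
Hypothesis y_inj : {in A &, injective y}.

Lemma size_node_poly i : i \in A -> size (node_poly A y i) = #|A|.
Proof.
by move=> iA; rewrite /node_poly -big_enum size_prod_XsubC -cardE [RHS](cardsD1 i) iA.
Qed.

Lemma node_poly_eq0 i j : j \in A -> j != i -> (node_poly A y i).[y j] = 0.
Proof.
move=> jA ji; rewrite horner_prod (bigD1 j) ?inE ?ji //=.
by rewrite hornerXsubC subrr mul0r.
Qed.

Lemma node_poly_neq0 i : i \in A -> (node_poly A y i).[y i] != 0.
Proof.
move=> iA; rewrite horner_prod; apply/prodf_neq0 => j /setD1P[ji jA].
rewrite hornerXsubC subr_eq0; apply: contraNneq ji => /y_inj -> //.
Qed.

(** The difference of the two sides vanishes at the [#|A|] nodes. *)
Lemma lagrange_interpolation (q : {poly F}) : (size q <= #|A|)%N ->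
  q = \sum_(i in A) (q.[y i] / (node_poly A y i).[y i]) *: node_poly A y i.
Proof.
move=> size_q; apply/eqP; rewrite -subr_eq0; apply/eqP.
set s := \sum_(i in A) _.
apply: (@roots_geq_poly_eq0 _ _ [seq y i | i <- enum A]).
- apply/allP => _ /mapP[i + ->]; rewrite mem_enum => iA.
  rewrite /root hornerD hornerN /s horner_sum (bigD1 i) //= big1 => [|j].
    by rewrite hornerZ divfK ?node_poly_neq0 // addr0 subrr.
  by case/andP=> jA ji; rewrite hornerZ (node_poly_eq0 (i := j) iA) ?mulr0 // eq_sym.
- rewrite map_inj_in_uniq ?enum_uniq // => i j.
  by rewrite !mem_enum; exact: y_inj.
- rewrite size_map -cardE (leq_trans (size_polyD _ _)) // geq_max size_q.
  rewrite size_polyN (leq_trans (size_sum _ _ _)) //.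
  apply/bigmax_leqP => i iA; apply: leq_trans (size_scale_leq _ _) _.
  by rewrite size_node_poly.
Qed.

(** The sum is the divided difference of [q], that is, the coefficient of
    degree [#|A|.-1] in its Lagrange interpolation, because node polynomials
    are monic of that degree. *)
Lemma divided_difference_eq0 (q : {poly F}) : (size q < #|A|)%N ->
  \sum_(i in A) q.[y i] / (node_poly A y i).[y i] = 0.
Proof.
move=> size_q; have := congr1 (fun p : {poly F} => p`_(#|A|.-1))
  (lagrange_interpolation (ltnW size_q)).
rewrite /= coef_sum nth_default => [coef_eq0|]; last by case: #|A| size_q.
rewrite [RHS]coef_eq0.
apply: eq_bigr => i iA; rewrite coefZ -[LHS]mulr1 -(size_node_poly iA).
by congr (_ * _); symmetry; exact/eqP/monic_prod_XsubC.
Qed.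

End Interpolation.

(** The weight of the divided difference at [y i] is the inverse of the product
    of the gaps [y j - y i], and exactly [i] of these gaps are negative. *)
Lemma alternating_dependence (R : realFieldType) n (y : 'I_n -> R) :
  (forall i j : 'I_n, (i < j)%N -> y i < y j) ->
  exists2 mu : 'I_n -> R, forall i, 0 < mu i &
    forall q : {poly R}, (size q < n)%N ->
      \sum_(i < n) (-1) ^+ i * mu i * q.[y i] = 0.
Proof.
move=> y_incr.
have y_inj : {in [set: 'I_n] &, injective y}.
  move=> i j _ _ yij; apply: val_inj => /=.
  by case: (ltngtP i j) => // /y_incr; rewrite yij ltxx.
pose gaps i := \prod_(j in [set: 'I_n] :\ i) (y j - y i).
exists (fun i : 'I_n => (-1) ^+ i / gaps i) => [i|q size_q].
  have -> : (-1) ^+ i / gaps i =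
      \prod_(j in [set: 'I_n] :\ i) ((-1) ^+ (j < i)%N / (y j - y i)).
    rewrite prodf_div -expr_sum; congr ((-1) ^+ _ / _).
    have := card_ord i; rewrite -sum1_card.
    rewrite (big_ord_widen n (fun=> 1%N)) 1?ltnW // big_mkcond /= => {1}<-.
    rewrite (bigD1 i) //= ltnn add0n; apply: eq_big => j; first by rewrite !inE andbT.
    by case: ltnP.
  apply: prodr_gt0 => j /setD1P[ji _].
  case: (ltngtP j i) ji => [ji _|ij _|/val_inj -> /eqP //].
    by rewrite expr1 mulN1r -invrN opprB invr_gt0 subr_gt0 y_incr.
  by rewrite expr0 mul1r invr_gt0 subr_gt0 y_incr.
have /(divided_difference_eq0 y_inj) : (size q < #|[set: 'I_n]|)%N.
  by rewrite cardsT card_ord.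
move/(congr1 ( *%R ((-1) ^+ n.-1))); rewrite mulr0 mulr_sumr.
apply: etrans.
apply: eq_big => [i|i _]; first by rewrite inE.
have -> : gaps i = (-1) ^+ n.-1 * (node_poly [set: 'I_n] y i).[y i].
  rewrite horner_prod; have -> : n.-1 = #|[set: 'I_n] :\ i|.
    by rewrite -{1}(card_ord n) -cardsT (cardsD1 i) inE.
  rewrite -prodr_const -big_split; apply: eq_bigr => j _ /=.
  by rewrite hornerXsubC mulN1r opprB.
rewrite invfM -exprVn invrN1 mulrCA mulrA -expr2 sqrr_sign.
by rewrite mul1r -!mulrA [X in _ * X]mulrC.
Qed.

(** * Dependences with the signs of a colouring *)

(** As changes separate runs of equal colours, this is also the index of the run
    that contains position [j]. *)
Definition turns (b : nat -> bool) (j : nat) : nat :=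
  (\sum_(i < j) (b i != b i.+1))%N.

Lemma turnsS b j : turns b j.+1 = (turns b j + (b j != b j.+1))%N.
Proof. exact: big_ord_recr. Qed.

Lemma turns_mono b i j : (i <= j)%N -> (turns b i <= turns b j)%N.
Proof.
move=> /subnKC <-; elim: (j - i)%N => [|k IHk]; first by rewrite addn0.
by rewrite addnS turnsS; apply: leq_trans IHk (leq_addr _ _).
Qed.

Lemma turns_lt b i j : (turns b i < turns b j)%N -> (i < j)%N.
Proof.
move=> lt_t; rewrite ltnNge.
by apply: contraL lt_t => /turns_mono; rewrite -leqNgt.
Qed.

(** The index of a run determines its colour. *)
Lemma odd_turns b j : odd (turns b j) = b 0 (+) b j.
Proof.
elim: j => [|j IHj]; first by rewrite /turns big_ord0 addbb.
rewrite turnsS oddD IHj; by case: (b 0) (b j) (b j.+1) => -[] [].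
Qed.

Lemma turns_onto b n k : (k <= turns b n)%N ->
  exists2 j, (j <= n)%N & turns b j = k.
Proof.
elim: n => [|n IHn] le_k.
  by exists 0%N => //; move: le_k; rewrite /turns !big_ord0; case: k.
have [/IHn[j le_jn <-]|lt_k] := leqP k (turns b n).
  by exists j => //; exact: leqW.
by exists n.+1 => //; move: le_k; rewrite turnsS; case: (_ != _); lia.
Qed.

(** Any position belongs to a system of representatives of [d.+2] consecutive
    runs. *)
Lemma consecutive_turns b n d v : (d < turns b n)%N -> (v <= n)%N ->
  exists a (x : 'I_d.+2 -> nat),
    [/\ forall r, (x r <= n)%N, forall r, turns b (x r) = (a + r)%N
      & exists r, x r = v].
Proof.
move=> lt_d le_v; have le_t := turns_mono b le_v.
(* The window of runs starts at the run of [v], unless this would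
   exceed the last run. *)
pose a := minn (turns b v) (turns b n - d.+1)%N.
have [pos pos_le pos_turns] : exists2 pos : 'I_d.+2 -> nat,
    forall r, (pos r <= n)%N & forall r, turns b (pos r) = (a + r)%N.
  have /fin_all_exists[pos posP] (r : 'I_d.+2) :
      exists j, (j <= n)%N /\ turns b j = (a + r)%N.
    have [j ? ?] : exists2 j, (j <= n)%N & turns b j = (a + r)%N.
      by apply: turns_onto; have := ltn_ord r; rewrite /a; lia.
    by exists j.
  by exists pos => r; case: (posP r).
have r0_lt : (turns b v - a < d.+2)%N by rewrite /a; lia.
pose r0 := Ordinal r0_lt.
exists a, (fun r => if r == r0 then v else pos r); split=> [r|r|].
- by case: ifP.
- by case: eqP => // -> /=; rewrite /a; lia.
- by exists r0; rewrite eqxx.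
Qed.

Section Alternation.
Variables (R : realFieldType) (n d : nat) (u : nat -> R) (b : nat -> bool).
Hypothesis u_incr : forall i j, (i < j)%N -> (j <= n)%N -> u i < u j.

(** Consecutive runs alternate in colour, so the alternating dependence
    supported by representatives of [d.+2] consecutive runs, one of them [v],
    follows the colouring on its support. *)
Lemma dependence_through v : (d < turns b n)%N -> (v <= n)%N ->
  exists l : 'I_n.+1 -> R,
    [/\ forall i : 'I_n.+1, 0 <= (-1) ^+ b i * l i,
        forall i : 'I_n.+1, i = v :> nat -> 0 < (-1) ^+ b i * l i
      & forall q : {poly R}, (size q <= d.+1)%N -> \sum_i l i * q.[u i] = 0].
Proof.
move=> lt_d le_v; have [a [x [x_le x_turns [r0 x_r0]]]] := consecutive_turns lt_d le_v.
have [|mu mu_gt0 mu_dep] := @alternating_dependence R _ (u \o x).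
  move=> i j lt_ij /=; apply: u_incr => //.
  by apply: (@turns_lt b); rewrite !x_turns ltn_add2l.
pose l (i : 'I_n.+1) := \sum_(r | x r == i) (-1) ^+ (b 0 + a) * ((-1) ^+ r * mu r).
have signed_l (i : 'I_n.+1) : (-1) ^+ b i * l i = \sum_(r | x r == i) mu r.
  rewrite /l mulr_sumr; apply: eq_bigr => r /eqP x_r.
  rewrite !mulrA -!exprD -signr_odd -x_r !oddD !oddb.
  have := odd_turns b (x r); rewrite x_turns oddD.
  by case: (b (x r)) (b 0) (odd a) (odd r) => -[] [] [] //=; rewrite mul1r.
exists l; split=> [i|i i_v|q size_q].
- by rewrite signed_l sumr_ge0 // => r _; exact: ltW.
- rewrite signed_l (bigD1 r0) ?x_r0 ?i_v //= ltr_wpDr //.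
  by apply: sumr_ge0 => r _; exact: ltW.
- transitivity ((-1) ^+ (b 0 + a)
      * \sum_(r < d.+2) (-1) ^+ r * mu r * q.[(u \o x) r]); last first.
    by rewrite mu_dep ?mulr0.
  rewrite mulr_sumr; pose xo r : 'I_n.+1 := inord (x r).
  rewrite [RHS](partition_big xo xpredT) //=; apply: eq_bigr => i _.
  rewrite mulr_suml; apply: eq_big => [r|r /eqP <-]; last by rewrite !mulrA.
  by rewrite -val_eqE /= inordK // ltnS.
Qed.

(** One root inside each gap where the colour changes makes the polynomial
    change sign exactly together with the colouring. *)
Lemma separating_poly : (turns b n <= d)%N ->
  exists2 q : {poly R}, (size q <= d.+1)%N &
    forall i, (i <= n)%N -> 0 < (-1) ^+ (b 0 (+) b i) * q.[u i].
Proof.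
move=> le_d; pose mid i := (u i + u i.+1) / 2.
exists (\prod_(i < n | b i != b i.+1) ((mid i)%:P - 'X)).
  apply: leq_trans (size_poly_prod_leq _ _) _.
  rewrite (eq_bigr (fun=> 2%N)) => [|i _]; last first.
    by rewrite -size_polyN opprB size_XsubC.
  rewrite sum_nat_const -sum1_card big_mkcond /=.
  have -> : (\sum_(i < n) (if b i != b i.+1 then 1 else 0))%N = turns b n.
    by apply: eq_bigr => i _; case: (_ != _).
  lia.
move=> j le_jn; rewrite -odd_turns signr_odd horner_prod.
have -> : turns b j = (\sum_(i < n | b i != b i.+1) (i < j))%N.
  rewrite /turns (big_ord_widen n (fun i => nat_of_bool (b i != b i.+1))) //.
  rewrite [LHS]big_mkcond [RHS]big_mkcond /=; apply: eq_bigr => i _.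
  by case: ltnP; case: (_ != _).
rewrite expr_sum -big_split; apply: prodr_gt0 => i _ /=.
rewrite hornerD hornerN hornerX hornerC /mid.
have step : u i < u i.+1 by apply: u_incr.
case: ltnP => [lt_ij|le_ji].
  have : u i.+1 <= u j.
    by move: lt_ij; rewrite leq_eqVlt => /predU1P[->|/u_incr/(_ le_jn)/ltW].
  rewrite expr1; lra.
have : u j <= u i.
  by move: le_ji; rewrite leq_eqVlt => /predU1P[->|/u_incr/(_ (ltnW (ltn_ord i)))/ltW].
rewrite expr0; lra.
Qed.

(** A separating polynomial pairs strictly positively with every dependence
    that has the signs of the colouring, so none exists when there are few
    changes. Otherwise the dependences through the single points have compatible
    signs, and their sum is nonzero everywhere. *)
Lemma signed_dependenceP :
  (exists2 l : 'I_n.+1 -> R, forall i : 'I_n.+1, 0 < (-1) ^+ b i * l i &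
     forall q : {poly R}, (size q <= d.+1)%N -> \sum_i l i * q.[u i] = 0)
  <-> (d < turns b n)%N.
Proof.
split=> [[l l_sign l_dep]|lt_d].
  rewrite ltnNge; apply/negP => /separating_poly[q /l_dep l_q q_sign].
  suff : 0 < (-1) ^+ b 0 * \sum_i l i * q.[u i] by rewrite l_q mulr0 ltxx.
  rewrite mulr_sumr (bigD1 ord0) //=.
  have term_gt0 (i : 'I_n.+1) : 0 < (-1) ^+ b 0 * (l i * q.[u i]).
    have := mulr_gt0 (l_sign i) (q_sign i (ltn_ord i)).
    rewrite signr_addb; set s := (-1) ^+ b i.
    have -> : s * l i * ((-1) ^+ b 0 * s * q.[u i])
        = s * s * ((-1) ^+ b 0 * (l i * q.[u i])) by ring.
    by rewrite -expr2 sqrr_sign mul1r.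
  by rewrite ltr_wpDr ?term_gt0 // sumr_ge0 // => i _; rewrite ltW.
have /fin_all_exists[l lP] (v : 'I_n.+1) := dependence_through lt_d (ltn_ord v).
exists (fun i => \sum_v l v i) => [i|q size_q].
  rewrite mulr_sumr (bigD1 i) //= ltr_wpDr //.
    by apply: sumr_ge0 => v _; case: (lP v).
  by case: (lP i) => _ /(_ i erefl).
under eq_bigr do rewrite mulr_suml.
by rewrite exchange_big big1 // => v _; case: (lP v) => _ _ ->.
Qed.
End Alternation.

Local Open Scope classical_set_scope.

(** * Simplices with vertices on the moment curve *)

Section Hulls.
Variables (R : realType) (d : nat) (V : finType) (p : V -> 'rV[R]_d).

Definition convex_coeffs (e : {set V}) (a : V -> R) : Prop :=
  (forall v, v \in e -> 0 <= a v) /\ \sum_(v in e) a v = 1.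

(** Induction on the number of points: one point is split off and the remaining
    weights are rescaled, unless their total is zero. *)
Lemma convex_set_combination (M : set 'rV[R]_d) (e : {set V}) (a : V -> R) :
  @convex_set R 'rV[R]_d M -> (forall v, v \in e -> M (p v)) ->
  convex_coeffs e a -> M (\sum_(v in e) a v *: p v).
Proof.
move=> M_convex; move: {2}#|e| (erefl #|e|) => n.
elim: n e a => [|n IHn] e a card_e Mp [a_ge0 a_sum].
  move: a_sum; rewrite (cards0_eq card_e) big_set0 => /eqP.
  by rewrite eq_sym oner_eq0.
have /card_gt0P[v ve] : (0 < #|e|)%N by rewrite card_e.
have card_e' : #|e :\ v| = n by apply: succn_inj; rewrite -card_e (cardsD1 v e) ve.
have a_ge0' w : w \in e :\ v -> 0 <= a w by move=> /setD1P[_ /a_ge0].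
move: a_sum; rewrite !(big_setD1 v ve) /=.
set S := \sum_(w in e :\ v) a w => a_sum.
have S_ge0 : 0 <= S by exact: sumr_ge0.
have [S0|S_neq0] := eqVneq S 0.
  have -> : a v = 1 by rewrite -a_sum S0 addr0.
  rewrite scale1r big1 ?addr0 => [|w we]; first exact: Mp.
  by rewrite (psumr_eq0P a_ge0' S0) // scale0r.
have av_ge0 : 0 <= a v by exact: a_ge0.
have av_le1 : a v <= 1 by rewrite -a_sum lerDl.
have /mem_set My : M (\sum_(w in e :\ v) (a w / S) *: p w).
  apply: IHn => // [w /setD1P[_ /Mp] //|]; split => [w /a_ge0' aw|].
    by rewrite divr_ge0.
  by rewrite -mulr_suml divff.
have /mem_set Mv := Mp _ ve.
have /set_mem := M_convex _ _ (Itv01 av_ge0 av_le1) Mv My.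
congr M; rewrite /conv /= scaler_sumr; congr (_ + _).
apply: eq_bigr => w we; rewrite scalerA; congr (_ *: _).
have -> : unstable.onem (a v) = S by rewrite /unstable.onem; lra.
by rewrite mulrC divfK.
Qed.

Lemma convex_hull_imageP (e : {set V}) x :
  convex_hull [set p v | v in [set` e]] x <->
  exists2 a, convex_coeffs e a & x = \sum_(v in e) a v *: p v.
Proof.
split=> [|[a a_coeffs ->] M [M_convex Mp]]; last first.
  by apply: convex_set_combination => // v ve; apply: Mp; exists v.
pose C := [set y | exists2 a, convex_coeffs e a & y = \sum_(v in e) a v *: p v].
suff [C_convex Cp] : @convex_set R 'rV[R]_d C /\ [set p v | v in [set` e]] `<=` C.
  exact: (smallest_sub C_convex Cp).
split=> [y z k /set_mem[a [a_ge0 a_sum] ->] /set_mem[b [b_ge0 b_sum] ->]|].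
  apply/mem_set; exists (fun v => k%:num * a v + (1 - k%:num) * b v); first split.
  - move=> v ve; by rewrite addr_ge0 // mulr_ge0 ?a_ge0 ?b_ge0 // subr_ge0.
  - by rewrite big_split /= -!mulr_sumr a_sum b_sum !mulr1 addrC subrK.
  - rewrite /conv /= !scaler_sumr -big_split; apply: eq_bigr => v _ /=.
    by rewrite [RHS]scalerDl !scalerA.
move=> _ [v /= ve <-]; exists (fun w => (w == v)%:R); first split.
- by move=> w _; rewrite ler0n.
- by rewrite (big_setD1 v ve) /= eqxx big1 ?addr0 // => w /setD1P[/negPf ->].
- rewrite (big_setD1 v ve) /= eqxx scale1r big1 ?addr0 //.
  by move=> w /setD1P[/negPf ->]; rewrite scale0r.
Qed.

(** From a point [x] of the relative interior one may move a little further away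
    from the barycentre [c] without leaving the simplex. Then [x] is a proper
    mixture of the point [y] so reached with [c], all of whose coordinates are
    positive. *)
Lemma relative_interior_positive (e : {set V}) x : (0 < #|e|)%N ->
  relative_interior (convex_hull [set p v | v in [set` e]]) x ->
  exists a, [/\ forall v, v \in e -> 0 < a v, \sum_(v in e) a v = 1
    & x = \sum_(v in e) a v *: p v].
Proof.
move=> e_gt0 [hull_x]; rewrite /within /= => /nbhs_normP[r /= r_gt0 ball_hull].
pose m : R := #|e|%:R^-1; pose c := \sum_(v in e) m *: p v.
have m_gt0 : 0 < m by rewrite invr_gt0 ltr0n.
have m_sum : \sum_(v in e) m = 1.
  by rewrite sumr_const -mulr_natr mulVf // pnatr_eq0 -lt0n.
have hull_c : convex_hull [set p v | v in [set` e]] c.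
  by apply/convex_hull_imageP; exists (fun=> m) => //; split=> // v _; exact: ltW.
(* Small enough for [k *: (x - c)] to have norm less than [r]. *)
pose k := r / 2 / (1 + `|x - c|).
have den_gt0 : 0 < 1 + `|x - c| by rewrite ltr_pwDl.
have k_gt0 : 0 < k by rewrite !divr_gt0.
pose y := x + k *: (x - c).
have /ball_hull : ball_ (@Num.norm R _) x r y.
  rewrite /ball_ /= /y opprD addrA subrr sub0r normrN normrZ gtr0_norm //.
  rewrite /k mulrAC ltr_pdivrMr // mulrDr mulr1.
  have : 0 <= `|x - c| by [].
  nra.
have aff_y : affine_hull (convex_hull [set p v | v in [set` e]]) y.
  exists 2, (fun i => if i == ord0 then x else c),
    (fun i => if i == ord0 then 1 + k else - k); split.
  - by move=> i; case: ifP.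
  - by rewrite !big_ord_recl big_ord0 /= addr0 addrK.
  - by rewrite !big_ord_recl big_ord0 /= addr0 scalerDl scale1r scaleNr /y scalerBr addrA.
move=> /(_ aff_y) /convex_hull_imageP[a [a_ge0 a_sum] y_a].
have k1_gt0 : 0 < 1 + k by rewrite ltr_pwDl // ltW.
exists (fun v => (a v + k * m) / (1 + k)); split.
- by move=> v ve; rewrite divr_gt0 // ltr_wpDl ?mulr_gt0 ?a_ge0.
- by rewrite -mulr_suml big_split /= a_sum -mulr_sumr m_sum mulr1 divff ?gt_eqF.
- have -> : x = (1 + k)^-1 *: (y + k *: c).
    rewrite /y scalerBr addrA subrK -{2}[x]scale1r -scalerDl scalerA.
    by rewrite mulVf ?scale1r // gt_eqF.
  rewrite y_a /c scaler_sumr -big_split scaler_sumr; apply: eq_bigr => v _ /=.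
  by rewrite scalerA -scalerDl scalerA mulrC.
Qed.

End Hulls.

Section MomentCurve.
Variables (R : realType) (d : nat) (V : finType) (t : V -> R) (p : V -> 'rV[R]_d).
Hypothesis t_inj : injective t.
Hypothesis pE : forall v, p v = \row_(i < d) t v ^+ i.+1.

(** The affine functional on the ambient space whose restriction to the moment
    curve is the polynomial [q] of degree at most [d]. *)
Definition poly_functional (q : {poly R}) (y : 'rV[R]_d) : R :=
  q`_0 + \sum_(i < d) q`_i.+1 * y 0 i.

Lemma poly_functional_curve (q : {poly R}) v : (size q <= d.+1)%N ->
  poly_functional q (p v) = q.[t v].
Proof.
move=> size_q; rewrite (horner_coef_wide _ size_q) big_ord_recl expr0 mulr1.
by congr (_ + _); apply: eq_bigr => i _; rewrite pE mxE.
Qed.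

Lemma poly_functional_sum (I : finType) (P : pred I) (a : I -> R)
    (y : I -> 'rV[R]_d) (q : {poly R}) : \sum_(i | P i) a i = 1 ->
  poly_functional q (\sum_(i | P i) a i *: y i) =
  \sum_(i | P i) a i * poly_functional q (y i).
Proof.
move=> a_sum; rewrite /poly_functional -{1}[q`_0]mul1r -a_sum mulr_suml.
under [X in _ + X]eq_bigr do rewrite summxE mulr_sumr.
rewrite exchange_big -big_split; apply: eq_bigr => i _ /=.
rewrite mulrDr mulr_sumr; congr (_ + _); apply: eq_bigr => j _.
by rewrite mxE mulrCA.
Qed.

Lemma poly_functional_combination (e : {set V}) (a : V -> R) (q : {poly R}) :
  \sum_(v in e) a v = 1 -> (size q <= d.+1)%N ->
  poly_functional q (\sum_(v in e) a v *: p v) = \sum_(v in e) a v * q.[t v].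
Proof.
move=> a_sum size_q; rewrite poly_functional_sum //.
by apply: eq_bigr => v _; rewrite poly_functional_curve.
Qed.

Lemma poly_functional_continuous q : continuous (poly_functional q).
Proof.
move=> y; rewrite /poly_functional.
apply: (@cvgD R R^o _ (nbhs y) _ (fun=> q`_0)); first exact: cvg_cst.
apply: (@cvg_big R^o); first exact: add_continuous.
move=> i _; apply: (@cvgM R _ (nbhs y) _ (fun=> q`_i.+1)); first exact: cvg_cst.
exact: coord_continuous.
Qed.

(** The functionals of the normalised node polynomials are barycentric
    coordinates on the affine hull of the vertices. They are continuous, hence
    still positive on the points of the hull near [x]. *)
Lemma positive_relative_interior (e : {set V}) (a : V -> R) : (#|e| <= d.+1)%N ->
  (forall v, v \in e -> 0 < a v) -> \sum_(v in e) a v = 1 ->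
  relative_interior (convex_hull [set p v | v in [set` e]])
    (\sum_(v in e) a v *: p v).
Proof.
move=> card_e a_gt0 a_sum; set H := convex_hull _; set x := \sum_(v in e) _.
pose l v := (node_poly e t v).[t v]^-1 *: node_poly e t v.
have size_l v : v \in e -> (size (l v) <= d.+1)%N.
  by move=> ve; rewrite (leq_trans (size_scale_leq _ _)) // size_node_poly.
have l_eval v w : v \in e -> w \in e -> (l v).[t w] = (w == v)%:R.
  move=> ve we; rewrite hornerZ; case: eqP => [->|/eqP wv].
    by rewrite mulVf // node_poly_neq0 //; exact: in2W.
  by rewrite (node_poly_eq0 _ we wv) mulr0.
have l_coord b v : v \in e -> \sum_(w in e) b w = 1 ->
    poly_functional (l v) (\sum_(w in e) b w *: p w) = b v.
  move=> ve b_sum; rewrite poly_functional_combination ?size_l //.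
  rewrite (big_setD1 v ve) /= l_eval // eqxx mulr1 big1 ?addr0 //.
  by move=> w /setD1P[/negPf wv we]; rewrite l_eval // wv mulr0.
split.
  by apply/convex_hull_imageP; exists a => //; split=> // v /a_gt0/ltW.
rewrite /within /=.
have : \forall y \near x, forall v, v \in e -> 0 < poly_functional (l v) y.
  apply: (@filter_forall _ V (fun v y => v \in e -> 0 < poly_functional (l v) y)
    (nbhs x)).
  move=> v; case: (boolP (v \in e)) => [ve|/negP ve]; last first.
    by apply: nearW => y ye; case: ve.
  have : poly_functional (l v) y @[y --> x] --> poly_functional (l v) x.
    exact: poly_functional_continuous.
  move=> /cvgr_gt /(_ 0); rewrite l_coord // => /(_ (a_gt0 _ ve)).
  by apply: filterS.
apply: filterS => y y_gt0 [n [z [w [z_hull w_sum y_def]]]].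
have /fin_all_exists[b bP] i :
    exists b, convex_coeffs e b /\ z i = \sum_(v in e) b v *: p v.
  by have /convex_hull_imageP[b] := z_hull i; exists b.
have y_comb : y = \sum_(v in e) (\sum_i w i * b i v) *: p v.
  under eq_bigr do rewrite scaler_suml.
  rewrite exchange_big y_def; apply: eq_bigr => i _ /=.
  case: (bP i) => _ ->; rewrite scaler_sumr; apply: eq_bigr => v _.
  by rewrite scalerA.
have y_sum : \sum_(v in e) \sum_i w i * b i v = 1.
  rewrite exchange_big -w_sum; apply: eq_bigr => i _ /=.
  by rewrite -mulr_sumr; case: (bP i) => -[_ ->] _; rewrite mulr1.
apply/convex_hull_imageP; exists (fun v => \sum_i w i * b i v) => //.
by split=> // v ve; have := y_gt0 v ve; rewrite {1}y_comb l_coord // => /ltW.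
Qed.

(** Monomials of degree [1] to [d] read off the coordinates of a point of the
    moment curve, and the constants account for the total weights. *)
Lemma combination_eqP (e f : {set V}) (a b : V -> R) :
  \sum_(v in e) a v = 1 -> \sum_(v in f) b v = 1 ->
  \sum_(v in e) a v *: p v = \sum_(v in f) b v *: p v <->
  forall q : {poly R}, (size q <= d.+1)%N ->
    \sum_(v in e) a v * q.[t v] = \sum_(v in f) b v * q.[t v].
Proof.
move=> a_sum b_sum; split=> [eq_ab q size_q|eq_ab].
  by rewrite -!poly_functional_combination // eq_ab.
apply/rowP => i; rewrite !summxE.
have coord (c : R) v : (c *: p v) 0 i = c * ('X^(i.+1)).[t v].
  by rewrite hornerXn mxE pE mxE.
under eq_bigr do rewrite coord; under [RHS]eq_bigr do rewrite coord.
by apply: eq_ab; rewrite size_polyXn ltnS.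
Qed.

End MomentCurve.

(** A common point of the two relative interiors has positive barycentric
    coordinates on both sides; their difference is the dependence. Conversely,
    evaluation on the constant polynomial shows that the weights of a dependence
    on [e] and on its complement have opposite totals, and dividing by this
    total gives back two convex combinations of the same point. *)
Lemma crossing_signedP (R : realType) d (t : 'I_(2 * d) -> R)
    (p : 'I_(2 * d) -> 'rV[R]_d) (e : {set 'I_(2 * d)}) :
  injective t -> (forall v, p v = \row_(i < d) t v ^+ i.+1) ->
  (0 < d)%N -> e \in hyperedges d ->
  crossing p e (~: e) <->
  exists2 l : 'I_(2 * d) -> R, forall v, 0 < (-1) ^+ (v \in e) * l v &
    forall q : {poly R}, (size q <= d.+1)%N -> \sum_v l v * q.[t v] = 0.
Proof.
move=> t_inj pE d_gt0; rewrite inE => /eqP card_e.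
have card_f : #|~: e| = d by rewrite cardsCs finset.setCK card_e card_ord; lia.
split=> [[_ [x [x_e x_f]]]|[l l_sign l_dep]].
  have [|a [a_gt0 a_sum x_a]] := relative_interior_positive _ x_e.
    by rewrite card_e.
  have [|b [b_gt0 b_sum x_b]] := relative_interior_positive _ x_f.
    by rewrite card_f.
  exists (fun v => if v \in e then - a v else b v) => [v|q size_q].
    case: ifP => ve; first by rewrite mulN1r opprK a_gt0.
    by rewrite mul1r b_gt0 // inE ve.
  have := (combination_eqP pE a_sum b_sum).1; rewrite -x_a -x_b => /(_ erefl q size_q) eq_ab.
  rewrite (bigID (mem e)) /=.
  rewrite (eq_bigr (fun v => - (a v * q.[t v]))) => [|v ve]; last by rewrite ifT ?mulNr.
  rewrite [X in _ + X](eq_bigr (fun v => b v * q.[t v])) => [|v ve]; last by rewrite ifN.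
  rewrite sumrN eq_ab; apply/eqP; rewrite addrC subr_eq0; apply/eqP.
  by apply: eq_bigl => v; rewrite inE.
have l_e v : v \in e -> l v < 0.
  by move=> ve; have := l_sign v; rewrite ve mulN1r oppr_gt0.
have l_f v : v \in ~: e -> 0 < l v.
  by rewrite inE => /negPf ve; have := l_sign v; rewrite ve mul1r.
have split_sum (g : 'I_(2 * d) -> R) :
    \sum_v g v = \sum_(v in e) g v + \sum_(v in ~: e) g v.
  by rewrite (bigID (mem e)) /=; congr (_ + _); apply: eq_bigl => v; rewrite inE.
pose S := \sum_(v in ~: e) l v.
have S_gt0 : 0 < S.
  have /card_gt0P[v ve] : (0 < #|~: e|)%N by rewrite card_f.
  rewrite /S (big_setD1 v ve) /= ltr_pwDl ?l_f //.
  by apply: sumr_ge0 => w /setD1P[_ /l_f/ltW].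
have e_sum : \sum_(v in e) - l v / S = 1.
  rewrite -mulr_suml sumrN; have := l_dep 1; rewrite size_poly1 => /(_ isT).
  under eq_bigr do rewrite hornerC mulr1.
  by rewrite split_sum => /addr0_eq ->; rewrite divff ?gt_eqF.
have f_sum : \sum_(v in ~: e) l v / S = 1 by rewrite -mulr_suml divff ?gt_eqF.
split; first by rewrite -finset.setI_eq0 finset.setICr.
exists (\sum_(v in e) (- l v / S) *: p v); split.
  apply: (positive_relative_interior t_inj pE) => //; first by rewrite card_e.
  by move=> v /l_e lv; rewrite divr_gt0 // oppr_gt0.
have -> : \sum_(v in e) (- l v / S) *: p v = \sum_(v in ~: e) (l v / S) *: p v.
  apply/(combination_eqP pE e_sum f_sum) => q size_q.
  under eq_bigr do rewrite mulrAC mulNr.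
  under [RHS]eq_bigr do rewrite mulrAC.
  rewrite -!mulr_suml sumrN; congr (_ / _).
  by have := l_dep q size_q; rewrite split_sum => /addr0_eq.
apply: (positive_relative_interior t_inj pE) => //; first by rewrite card_f.
by move=> v /l_f lv; rewrite divr_gt0.
Qed.

(** * Crossing pairs and words *)

(** The rank of [v], the number of elements with a smaller parameter, is
    injective, hence a bijection; [s] is its inverse. *)
Lemma increasing_enumeration (R : realDomainType) (V : finType) (t : V -> R) n :
  injective t -> #|V| = n.+1 ->
  exists2 s : 'I_n.+1 -> V, bijective s &
    forall i j : 'I_n.+1, (i < j)%N -> t (s i) < t (s j).
Proof.
move=> t_inj card_V.
pose below v := [set w | t w < t v]%SET.
have below_lt v : (#|below v| < n.+1)%N.
  rewrite -card_V -cardsT; apply: proper_card.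
  by apply/properP; split; [exact: finset.subsetT | exists v; rewrite !inE ?ltxx].
pose rank v := Ordinal (below_lt v).
have rank_lt v w : t v < t w -> (rank v < rank w)%N.
  move=> lt_vw; apply: proper_card; apply/properP; split.
    by apply/fintype.subsetP => x; rewrite !inE => /lt_trans; apply.
  by exists v; rewrite !inE ?ltxx.
have rank_inj : injective rank.
  move=> v w /(congr1 val) /= eq_rank; apply: t_inj.
  by case: (ltgtP (t v) (t w)) => // /rank_lt; rewrite /= eq_rank ltnn.
have [s rankK sK] : bijective rank.
  by apply: inj_card_bij => //; rewrite card_ord card_V.
exists s; first by exists rank.
move=> i j lt_ij; rewrite ltNge; apply/negP; rewrite le_eqVlt => /predU1P[/t_inj eq_s|].
  by move: lt_ij; rewrite -[i]sK -[j]sK eq_s ltnn.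
by move=> /rank_lt; rewrite !sK => /(ltn_trans lt_ij); rewrite ltnn.
Qed.

Lemma turns_flips (b : nat -> bool) (n : nat) :
  turns b n = flips (b 0) [seq b i | i <- iota 1 n].
Proof.
suff gen m : (\sum_(i < n) (b (m + i) != b (m + i.+1)))%N
    = flips (b m) [seq b i | i <- iota m.+1 n].
  exact: (gen 0).
elim: n m => [|n IHn] m; first by rewrite big_ord0.
rewrite big_ord_recl addn0 addn1 /= -IHn; congr (_ + _)%N.
by apply: eq_bigr => i _; rewrite /bump /= !addSnnS.
Qed.

Section Counting.
Variables (R : realType) (d : nat) (t : 'I_(2 * d) -> R).
Variable p : 'I_(2 * d) -> 'rV[R]_d.
Hypothesis d_gt0 : (0 < d)%N.
Hypothesis t_inj : injective t.
Hypothesis pE : forall v, p v = \row_(i < d) t v ^+ i.+1.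
Local Notation n := (2 * d).-1.
Variable s : 'I_n.+1 -> 'I_(2 * d).
Hypothesis s_bij : bijective s.
Hypothesis s_incr : forall i j : 'I_n.+1, (i < j)%N -> t (s i) < t (s j).

(** The vertex of smallest parameter is left out: its colour is the same for
    all the sets that are counted. *)
Definition word (e : {set 'I_(2 * d)}) : n.-tuple bool :=
  [tuple s (lift ord0 i) \in e | i < n].

Lemma crossing_turnsP (e : {set 'I_(2 * d)}) : e \in hyperedges d ->
  crossing p e (~: e) <-> (d < turns (fun i => s (inord i) \in e) n)%N.
Proof.
move=> e_edge; have [r sK rK] := s_bij.
rewrite (crossing_signedP t_inj pE) //.
rewrite -(@signed_dependenceP R n d (fun i => t (s (inord i)))); last first.
  move=> i j lt_ij le_jn; apply: s_incr.
  by rewrite !inordK // ltnS ltnW ?(leq_trans lt_ij).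
split=> -[l l_sign l_dep].
  exists (l \o s) => [i|q size_q] /=.
    by have := l_sign (s i); rewrite inord_val.
  rewrite -[RHS](l_dep q size_q) [RHS](reindex s (onW_bij _ s_bij)) /=.
  by apply: eq_bigr => i _; rewrite inord_val.
exists (l \o r) => [v|q size_q] /=.
  by have := l_sign (r v); rewrite inord_val rK.
rewrite -[RHS](l_dep q size_q) (reindex s (onW_bij _ s_bij)) /=.
by apply: eq_bigr => i _; rewrite sK inord_val.
Qed.

Lemma turns_word (e : {set 'I_(2 * d)}) : s ord0 \in e ->
  turns (fun i => s (inord i) \in e) n = flips true (word e).
Proof.
move=> e0; rewrite turns_flips.
have -> : s (inord 0) \in e.
  by rewrite (_ : inord 0 = ord0) //; apply/val_inj; rewrite /= inordK.
congr flips; apply: (@eq_from_nth _ false); first by rewrite size_map size_iota size_tuple.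
move=> i; rewrite size_map size_iota => lt_in.
rewrite (nth_map 0) ?size_iota // nth_iota // (nth_mktuple _ false (Ordinal lt_in)).
congr (s _ \in e); apply: val_inj; rewrite /= inordK ?ltnS //.
Qed.

Lemma card_word (e : {set 'I_(2 * d)}) : s ord0 \in e -> #|e| = (count_mem true (word e)).+1.
Proof.
move=> e0; rewrite -sum1_card big_mkcond (reindex s (onW_bij _ s_bij)) /= big_ord_recl e0.
rewrite add1n; congr _.+1; rewrite count_map -sum1_count [RHS]big_mkcond big_enum.
by apply: eq_bigr => i _ /=; case: (_ \in e).
Qed.

(** Choosing the side that contains the vertex of smallest parameter picks one
    of the two hyperedges of each crossing pair. *)
Definition rooted_crossings : {set {set 'I_(2 * d)}} :=
  [set e in hyperedges d | (s ord0 \in e) && `[< crossing p e (~: e) >]]%SET.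

Lemma card_rooted_crossings : #|rooted_crossings| = crossing_count d.
Proof.
have [r sK rK] := s_bij.
rewrite -card_words_many_flips //.
have word_inj : {in rooted_crossings &, injective word}.
  move=> e f; rewrite !inE => /and3P[_ e0 _] /and3P[_ f0 _] eq_w.
  apply/finset.setP => v; rewrite -[v]rK.
  have [i ->|->] := unliftP ord0 (r v); last by rewrite e0 f0.
  by have := congr1 (fun w => tnth w i) eq_w; rewrite !tnth_mktuple.
rewrite -(card_in_imset word_inj); apply: eq_card => w; rewrite [RHS]inE.
apply/imsetP/andP => [[e]|[/eqP count_w flips_w]].
  rewrite inE => /and3P[e_edge e0 /asboolP /(crossing_turnsP e_edge)].
  rewrite turns_word // => flips_e ->; split=> //.
  by move: e_edge; rewrite inE card_word // => /eqP card_e; apply/eqP; lia.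
pose e := [set v | nth false (true :: w) (r v)]%SET.
have e0 : s ord0 \in e by rewrite inE sK.
have def_w : w = word e.
  by apply: eq_from_tnth => i; rewrite tnth_mktuple inE sK /= add0n (tnth_nth false).
have e_edge : e \in hyperedges d.
  by rewrite inE card_word // -def_w count_w prednK.
exists e => //; rewrite inE e_edge e0; apply/asboolP/(crossing_turnsP e_edge).
by rewrite turns_word // -def_w.
Qed.

Lemma crossing_sym (e f : {set 'I_(2 * d)}) : crossing p e f -> crossing p f e.
Proof. by case=> dis [x [x_e x_f]]; split; [rewrite disjoint_sym | exists x]. Qed.

Lemma crossing_setC (e f : {set 'I_(2 * d)}) : e \in hyperedges d -> f \in hyperedges d ->
  crossing p e f -> f = ~: e.
Proof.
rewrite !inE => /eqP card_e /eqP card_f [dis _].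
apply/eqP; rewrite eqEcard -finset.disjoints_subset disjoint_sym dis /=.
by rewrite cardsCs finset.setCK card_e card_f card_ord; lia.
Qed.

Lemma card_crossing_pairs : #|crossing_pairs p| = crossing_count d.
Proof.
rewrite -card_rooted_crossings.
have pair_inj : {in rooted_crossings &,
    injective (fun e : {set 'I_(2 * d)} => [set e; ~: e]%SET)}.
  move=> e f; rewrite !inE => /and3P[_ e0 _] /and3P[_ f0 _] eq_pair.
  have : e \in [set f; ~: f]%SET by rewrite -eq_pair !inE eqxx.
  by rewrite !inE => /orP[/eqP //|/eqP eq_e]; rewrite eq_e inE f0 in e0.
rewrite -(card_in_imset pair_inj); apply: eq_card => P.
apply/imset2P/imsetP => [[e f e_edge]|[e]].
  rewrite inE => /andP[f_edge /asboolP cr] ->.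
  have def_f := crossing_setC e_edge f_edge cr; subst f.
  have [e0|e0] := boolP (s ord0 \in e).
    by exists e => //; rewrite inE e_edge e0; apply/asboolP.
  exists (~: e)%SET; last by rewrite finset.setCK finset.setUC.
  rewrite inE f_edge inE e0; apply/asboolP; rewrite finset.setCK.
  exact: crossing_sym.
rewrite inE => /and3P[e_edge e0 cr] ->.
exists e (~: e)%SET => //; rewrite inE cr andbT inE cardsCs finset.setCK card_ord.
by move: e_edge; rewrite inE => /eqP ->; apply/eqP; lia.
Qed.

End Counting.

Lemma card_crossing_pairs_moment_curve (R : realType) (d : nat)
    (p : 'I_(2 * d) -> 'rV[R]_d) :
  (0 < d)%N -> injective p -> (forall v, moment_curve (p v)) ->
  #|crossing_pairs p| = crossing_count d.
Proof.
move=> d_gt0 p_inj p_curve.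
have /fin_all_exists[t pE] v : exists x : R, p v = \row_(i < d) x ^+ i.+1.
  by have [x _ <-] := p_curve v; exists x.
have t_inj : injective t by move=> v w eq_t; apply: p_inj; rewrite !pE eq_t.
have [|s s_bij s_incr] := @increasing_enumeration R _ t (2 * d).-1 t_inj.
  by rewrite card_ord prednK // muln_gt0.
exact: (card_crossing_pairs d_gt0 t_inj pE s_bij s_incr).
Qed.

(** The subtracted sums gather the words with at most [d] changes; their number
    of changes is grouped in pairs in the way that the parity of [d] allows. *)
Lemma crossing_count_formula d : (0 < d)%N ->
  (crossing_count d)%:Z =
    if odd d then
      'C(2 * d - 1, d - 1)%:Z - 1
      - \sum_(1 <= i < d./2.+1) ('C(d - 1, i) * 'C(d, i))%:Z
    else
      'C(2 * d - 1, d - 1)%:Z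
      - \sum_(1 <= i < d./2.+1) ('C(d, i) * 'C(d - 1, i - 1))%:Z.
Proof.
move=> d_gt0; rewrite -crossing_count_split //.
have sumZ (F : nat -> nat) : \sum_(1 <= i < d./2.+1) (F i)%:Z =
    (\sum_(1 <= i < d./2.+1) F i)%N%:Z by rewrite (big_morph Posz PoszD (erefl _)).
case: ifP => odd_d; rewrite sumZ.
  have -> : d.+1 = (2 * d./2.+1)%N by lia.
  rewrite sum_flip_weight_odd // big_ord_recl !bin0 subn1.
  rewrite (big_addn 0) big_mkord subn1 /=.
  under [X in _ - X%:Z]eq_bigr do rewrite addn1.
  by rewrite !PoszD; ring.
have {1}-> : d.+1 = (2 * d./2).+1 by lia.
rewrite sum_flip_weight_even // subn1.
under [X in _ - X%:Z]eq_bigr do rewrite subn1.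
by rewrite PoszD addrK.
Qed.

(** Both bounds are squared, so that they become the integral estimates
    [d * c ^ 2 <= 16 ^ d <= 256 * d * c ^ 2]. *)
Lemma crossing_count_Theta (R : realType) :
  (fun d : nat => (crossing_count d)%:R : R^o)
    =Theta_\oo (fun d : nat => 4 ^+ d / Num.sqrt d%:R : R^o).
Proof.
rewrite eqThetaE qualifE; apply/asboolP.
exists (16^-1, 1); first by rewrite /= invr_gt0 ltr0n ltr01.
exists 2%N => // d /= d_ge2; have d_gt0 : (0 < d)%N by exact: ltnW.
have sqrt_gt0 : 0 < Num.sqrt d%:R :> R by rewrite sqrtr_gt0 ltr0n.
have sqr_sqrt : Num.sqrt d%:R ^+ 2 = d%:R :> R by rewrite sqr_sqrtr ?ler0n.
have pow16 : (4 ^+ d) ^+ 2 = (16 ^ d)%N%:R :> R.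
  by rewrite -exprM mulnC exprM natrX; congr (_ ^+ d); rewrite -natrX.
have pow4_ge0 : 0 <= 4 ^+ d :> R by rewrite exprn_ge0.
rewrite (ger0_norm (divr_ge0 pow4_ge0 (ltW sqrt_gt0))) ger0_norm ?ler0n //; split.
  rewrite mulrA ler_pdivrMr // ler_pdivrMl ?ltr0n //.
  rewrite -(@ler_pXn2r _ 2) ?nnegrE ?mulr_ge0 ?ler0n ?(ltW sqrt_gt0) //.
  rewrite pow16 !exprMn sqr_sqrt -!natrX -!natrM ler_nat.
  by have := crossing_count_sqr_ge d_ge2; lia.
rewrite mul1r ler_pdivlMr //.
rewrite -(@ler_pXn2r _ 2) ?nnegrE ?mulr_ge0 ?ler0n ?(ltW sqrt_gt0) //.
rewrite pow16 exprMn sqr_sqrt -natrX -natrM ler_nat mulnC.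
exact: crossing_count_sqr_le.
Qed.

Theorem theorem2 (R : realType) :
  exists c : nat -> nat,
    [/\ forall (d : nat) (p : 'I_(2 * d) -> 'rV[R]_d),
          (2 <= d)%N -> injective p -> (forall v, moment_curve (p v)) ->
          #|crossing_pairs p| = c d,
        forall d : nat, (2 <= d)%N ->
          (c d)%:Z =
            if odd d then
              'C(2 * d - 1, d - 1)%:Z - 1
              - \sum_(1 <= i < d./2.+1) ('C(d - 1, i) * 'C(d, i))%:Z
            else
              'C(2 * d - 1, d - 1)%:Z
              - \sum_(1 <= i < d./2.+1) ('C(d, i) * 'C(d - 1, i - 1))%:Z
      & (fun d : nat => (c d)%:R : R^o)
          =Theta_\oo (fun d : nat => 4 ^+ d / Num.sqrt d%:R : R^o)].
Proof.
exists crossing_count; split.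
- by move=> d p /ltnW d_gt0; exact: card_crossing_pairs_moment_curve.
- by move=> d /ltnW; exact: crossing_count_formula.
- exact: crossing_count_Theta.
Qed.
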